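(* Every row contraction $T=[T_1,\ldots,T_n]$, $T_i\in B(\mathcal H)$, has a triangulation of type $$\begin{pmatrix}C_{\cdot0}&0\\ *&C_{\cdot1}\end{pmatrix}.$$ Moreover, this triangulation is uniquely determined.
   Context: $n\in\{1,2,\ldots\}$ or $n=\infty$; $T=[T_1,\ldots,T_n]$ with $T_i\in B(\mathcal H)$ (bounded operators on a complex Hilbert space) is a row contraction if $\sum_iT_iT_i^*\le I$. $\mathbb F_n^+$ is the free semigroup with generators $g_1,\ldots,g_n$; for $\alpha=g_{i_1}\cdots g_{i_k}$, $|\alpha|=k$ and $T_\alpha=T_{i_1}\cdots T_{i_k}$. A row contraction $T$ is of class $C_{\cdot0}$ if $\lim_{k\to\infty}\sum_{|\alpha|=k}\|T_\alpha^*h\|^2=0$ for every $h\in\mathcal H$, and of class $C_{\cdot1}$ if $\lim_{k\to\infty}\sum_{|\alpha|=k}\|T_\alpha^*h\|^2\ne0$ for every $h\in\mathcal H$, $h\ne0$. $T$ has a triangulation of type $\begin{pmatrix}C_{\cdot0}&0\\ *&C_{\cdot1}\end{pmatrix}$ if there is an orthogonal decomposition $\mathcal H=\mathcal H_0\oplus\mathcal H_1$ (either summand may be $\{0\}$) with respect to which $T_i=\begin{pmatrix}A_i&0\\ *&B_i\end{pmatrix}$, $i=1,\ldots,n$, where (i) $T_i^*\mathcal H_0\subset\mathcal H_0$ for every $i$; (ii) $[A_1,\ldots,A_n]$ is of class $C_{\cdot0}$; (iii) $[B_1,\ldots,B_n]$ is of class $C_{\cdot1}$. The entry $*$ is unspecified.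 Uniqueness means uniqueness of the decomposition $\mathcal H=\mathcal H_0\oplus\mathcal H_1$. *)

(* Defs.v *)
From HB Require Import structures.
From mathcomp Require Import all_boot all_order all_algebra.
From mathcomp Require Import all_classical all_reals all_analysis.
From mathcomp Require Import complex.
From mathcomp.analysis.showcase Require summability.

Set Implicit Arguments.
Unset Strict Implicit.
Unset Printing Implicit Defensive.

Import Order.TTheory GRing.Theory Num.Theory.
Import numFieldNormedType.Exports.

Local Open Scope classical_set_scope.
Local Open Scope ring_scope.
Local Open Scope complex_scope.

HB.mixin Record isHilbert (R : realType) H & CompleteNormedModule R[i] H := {
  inner : {dot H for @Num.conj R[i]} ;
  inner_norm : forall x : H, inner x x = `|x| ^+ 2
}.

#[short(type="hilbertType")]
HB.structure Definition Hilbert (R : realType) :=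
  {H of isHilbert R H & CompleteNormedModule R[i] H}.

Record bounded_op (R : realType) (H K : hilbertType R) := BoundedOp {
  bop_fun :> {linear H -> K} ;
  bop_bounded : exists M : R[i], forall h : H, `|bop_fun h| <= M * `|h|
}.

(* For a bounded linear f the set below is a singleton (Riesz). *)
Definition adjoint (R : realType) (H K : hilbertType R) (f : H -> K) : K -> H :=
  fun y => get [set z : H | forall x : H, inner (f x) y = inner x z].

Definition op_le (R : realType) (H : hilbertType R) (A B : H -> H) : Prop :=
  forall h : H, inner (A h) h <= inner (B h) h.

(* The norm of H takes (real) values in R[i]; rnorm is that value in R. *)
Definition rnorm (R : realType) (H : hilbertType R) (h : H) : R :=
  complex.Re `|h|.

Section closed_subspace.
Context (R : realType) (H : hilbertType R).

Record closed_subspace := ClosedSubspace {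
  csub_set : set H ;
  csub0 : csub_set 0 ;
  csubDZ : forall (a : R[i]) (x y : H),
    csub_set x -> csub_set y -> csub_set (a *: x + y) ;
  csub_closed : closed csub_set
}.

Definition csub_pred (M : closed_subspace) : {pred H} := mem (csub_set M).

End closed_subspace.

Section closed_subspace_hilbert.
Context (R : realType) (H : hilbertType R) (M : closed_subspace H).

Lemma csub_submod_closed : submod_closed (csub_pred M).
Proof.
split; first by rewrite inE; exact: csub0.
by move=> a x y; rewrite !inE; exact: csubDZ.
Qed.

HB.instance Definition _ :=
  GRing.isSubmodClosed.Build R[i] H (csub_pred M) csub_submod_closed.

Record csub_sort := CSub { csub_val : H ; csub_valP : csub_val \in csub_pred M }.
HB.instance Definition _ := [isSub for csub_val].
HB.instance Definition _ := [Choice of csub_sort by <:].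
HB.instance Definition _ := [SubChoice_isSubLmodule of csub_sort by <:].

Let csub_norm (x : csub_sort) : R[i] := `|csub_val x|.

Let csub_ler_normD x y : csub_norm (x + y) <= csub_norm x + csub_norm y.
Proof. exact: ler_normD. Qed.

Let csub_normrZ (l : R[i]) x : csub_norm (l *: x) = `|l| * csub_norm x.
Proof. by rewrite /csub_norm -normrZ. Qed.

Let csub_normr0_eq0 x : csub_norm x = 0 -> x = 0.
Proof. by move/normr0_eq0 => x0; apply/val_inj. Qed.

HB.instance Definition _ := Lmodule_isNormed.Build R[i] csub_sort
  csub_ler_normD csub_normrZ csub_normr0_eq0.

Let csub_complete (F : set_system csub_sort) :
  ProperFilter F -> cauchy F -> cvg F.
Proof.
move=> FF /cauchy_ballP Fc.
have /cauchy_cvg/cvg_ex[/= l Fl] : cauchy (csub_val @ F).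
  apply/cauchy_ballP => e /Fc [[A B] /= [FA FB] AB].
  exists (csub_val @` A, csub_val @` B) => /=.
    by split; [apply: filterS FA|apply: filterS FB] => x Ax; exists x.
  move=> [_ _] /= [[x Ax <-] [y By <-]].
  by have := AB (x, y) (conj Ax By); rewrite -!ball_normE.
have Ml : csub_set M l.
  apply: (@closed_cvg _ _ F _ csub_val (csub_set M) (@csub_closed _ _ M) _ l Fl).
  by apply: nearW => x; have := csub_valP x; rewrite inE.
apply/cvg_ex; exists (CSub (mem_set Ml)).
apply/cvgrPdist_lt => e e0.
by move/cvgrPdist_lt : Fl => /(_ e e0).
Qed.

HB.instance Definition _ := Uniform_isComplete.Build csub_sort csub_complete.

Definition csub_inner (x y : csub_sort) : R[i] := inner (csub_val x) (csub_val y).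

Let csub_inner_bilinear :
  bilinear_for ( *%R) (@Num.conj R[i] \; *%R) csub_inner.
Proof.
split=> [z a x y|z a x y]; rewrite /csub_inner.
- exact: linearPl.
- exact: linearPr.
Qed.

HB.instance Definition _ := bilinear_isBilinear.Build R[i] csub_sort csub_sort R[i]
  ( *%R) (@Num.conj R[i] \; *%R) csub_inner csub_inner_bilinear.

Let csub_inner_herm x y :
  csub_inner x y = (-1) ^+ false * Num.conj (csub_inner y x).
Proof. exact: hermitian_subproof. Qed.

HB.instance Definition _ := isHermitianSesquilinear.Build R[i] csub_sort false
  (@Num.conj R[i]) csub_inner csub_inner_herm.

Let csub_inner_gt0 x : x != 0 -> 0 < csub_inner x x.
Proof.
by move=> x0; apply: neq0_dnorm_gt0; apply: contra_neq x0 => x0; apply/val_inj.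
Qed.

HB.instance Definition _ := isDotProduct.Build R[i] csub_sort csub_inner csub_inner_gt0.

Let csub_inner_norm x : csub_inner x x = `|x| ^+ 2.
Proof. exact: inner_norm. Qed.

HB.instance Definition _ := isHilbert.Build R csub_sort csub_inner_norm.

End closed_subspace_hilbert.

Definition csub_hilbert (R : realType) (H : hilbertType R)
  (M : closed_subspace H) : hilbertType R := csub_sort M : hilbertType R.
Coercion csub_hilbert : closed_subspace >-> Hilbert.type.

Section row_contraction.
Context (R : realType) (H : hilbertType R) (I : choiceType).
Context (T : I -> bounded_op H H).

(* The sum over I converges in the strong operator topology; when I is finite
   it is the finite sum. *)
Definition row_contraction : Prop :=
  exists2 S : bounded_op H H,
    forall h : H,
      summability.partial_sum (fun i : I => T i (adjoint (T i) h))
        @ summability.totally --> S h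
    & op_le S idfun.

(* Words g_{i_1} ... g_{i_k} of the free semigroup are lists of letters. *)
Definition word_op (alpha : seq I) : H -> H :=
  foldr (fun i f => T i \o f) idfun alpha.

Definition word_sum (h : H) (k : nat) : \bar R :=
  \esum_(alpha in [set alpha : seq I | size alpha = k])
    (rnorm (adjoint (word_op alpha) h) ^+ 2)%:E.

Definition class_C_dot0 : Prop :=
  row_contraction /\ forall h : H, word_sum h @ \oo --> 0%E.

Definition class_C_dot1 : Prop :=
  row_contraction /\
  forall h : H, h != 0 -> exists2 l : \bar R, word_sum h @ \oo --> l & l != 0%E.

End row_contraction.

Section triangulation.
Context (R : realType) (H : hilbertType R).

Definition orthogonal_decomposition (H0 H1 : closed_subspace H) : Prop :=
  (forall (x0 : H0) (x1 : H1), inner (csub_val x0) (csub_val x1) = 0) /\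
  (forall h : H, exists (x0 : H0) (x1 : H1), h = csub_val x0 + csub_val x1).

(* The block matrix (A 0; X B) acts on columns (x0; x1) of H0 (+) H1. *)
Definition has_lower_block_form (H0 H1 : closed_subspace H)
    (T : bounded_op H H) (A : bounded_op H0 H0) (X : bounded_op H0 H1)
    (B : bounded_op H1 H1) : Prop :=
  forall (x0 : H0) (x1 : H1),
    T (csub_val x0 + csub_val x1) = csub_val (A x0) + csub_val (X x0 + B x1).

Definition triangulation_C0_C1 (I : choiceType) (T : I -> bounded_op H H)
    (H0 H1 : closed_subspace H) : Prop :=
  orthogonal_decomposition H0 H1 /\
  exists (A : I -> bounded_op H0 H0) (X : I -> bounded_op H0 H1)
    (B : I -> bounded_op H1 H1),
    [/\ forall i, has_lower_block_form (T i) (A i) (X i) (B i),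
        forall i h, csub_set H0 h -> csub_set H0 (adjoint (T i) h),
        class_C_dot0 A
      & class_C_dot1 B].

End triangulation.

(* Some m stands for n = m and None for n = oo. *)
Definition letters (n : option nat) : choiceType :=
  if n is Some m then 'I_m : choiceType else nat : choiceType.

(* Main.v *)
Require Import Defs.
From HB Require Import structures.
From mathcomp Require Import all_boot all_order all_algebra finmap.
From mathcomp Require Import all_classical all_reals all_analysis.
From mathcomp Require Import complex.
From mathcomp.analysis.showcase Require summability.
From mathcomp Require Import ring lra.

Set Implicit Arguments.
Unset Strict Implicit.
Unset Printing Implicit Defensive.

Import Order.TTheory GRing.Theory Num.Theory.
Import numFieldNormedType.Exports.

Local Open Scope classical_set_scope.
Local Open Scope ring_scope.

(** The limit of [word_sum T h] measures how much of [h] survives the powers of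
the row adjoint.  For a row contraction this sequence decreases from the square
of the norm of [h], so it has a finite limit [word_lim T h], and
  [word_lim T (x + y) <= 2 * word_lim T x + 2 * word_lim T y]
together with [word_lim T h <= nsq h] shows that the vectors with
[word_lim T h = 0] form a closed subspace [vanishing].  Prefixing a letter to
all words shows that each adjoint [T_i^*] maps this subspace into itself.  The
decomposition of the theorem is this subspace and its orthogonal complement.

In every decomposition [K0], [K1] that makes [T] lower triangular with diagonal
blocks [A] and [B], the adjoint of a word in [A] is the restriction to [K0] of
the adjoint of the word in [T], and the adjoint of a word in [B] is its
compression to [K1] (lemmas [block_adjoint_word0] and [block_adjoint_word1]).
Hence the word sums of [A] are those of [T] on [K0], and the word sums of [B]
are at most those of [T].  The first fact makes the block on [vanishing] of
class C.0.  The block on the complement is of class C.1 by [block_word_lim]: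
if [T_s] denotes the product along the word [s], then
  [word_lim T h] <= sum over words [s] of length [k] of [word_lim T (T_s^* h)],
and in each term only the component of [T_s^* h] orthogonal to [vanishing]
contributes, so the right-hand side is at most twice the word sum of [B] at
length [k].  If the word sums of [B] tend to 0, then [h] lies both in
[vanishing] and in its complement.  The inequality itself (lemma
[word_lim_words]) is a reverse Fatou lemma, and this is where summability of
the squares of the norms of [T_i^* h] is used when there are infinitely many
letters.

Uniqueness ([triangulation_vanishing]): if [K0], [K1] is such a triangulation,
then [K0] is contained in [vanishing] because [A] is C.0.  Conversely, the
component in [K1] of a vector of [vanishing] has vanishing word sums for [B],
hence is 0 because [B] is C.1.  Finally [K1] is the complement of [K0].

Two foundations carry the argument.  The Riesz theorem, obtained by minimizing
a quadratic functional, yields adjoints of bounded operators and, as the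
adjoint of the inclusion, the orthogonal projection on a closed subspace.  And
the convergence and order conditions in the definition of a row contraction
together amount to the finite inequalities [row_bound], which pass at once to
the diagonal blocks. *)

(** * The real inner product *)

Section real_inner.
Context (R : realType) (H : hilbertType R).
Implicit Types (x y z h : H) (a : R[i]) (t e : R).

(** Since the order of [R[i]] is only partial, estimates are made with the squared
norm and the real part of the inner product; [inner_rip] and [inner_eq0]
recover the complex inner product from [rip]. *)
Definition nsq h : R := rnorm h ^+ 2.
Definition rip x y : R := complex.Re (inner x y).

Lemma inner_nsq x : inner x x = (nsq x)%:C%C.
Proof.
by rewrite inner_norm /nsq /rnorm rmorphXn/= RRe_real// normr_real.
Qed.

Lemma rip_nsq x : rip x x = nsq x.
Proof. by rewrite /rip inner_nsq. Qed.

Lemma rnorm_ge0 x : 0 <= rnorm x.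
Proof. by rewrite /rnorm -ler0c RRe_real ?normr_real// normr_ge0. Qed.

Lemma nsq_ge0 x : 0 <= nsq x.
Proof. exact: sqr_ge0. Qed.

Lemma norm_rnorm x : `|x| = (rnorm x)%:C%C.
Proof. by rewrite /rnorm RRe_real// normr_real. Qed.

Lemma nsq_eq0 x : nsq x = 0 -> x = 0.
Proof.
move/eqP; rewrite sqrf_eq0 => /eqP x0.
by apply/normr0_eq0; rewrite norm_rnorm x0.
Qed.

Lemma inner_conj x y : inner x y = Num.conj (inner y x).
Proof. by rewrite [LHS]hermC/= expr0 mul1r. Qed.

Lemma ripC x y : rip x y = rip y x.
Proof. by rewrite /rip inner_conj; case: (inner y x). Qed.

Lemma ripDl x y z : rip (x + y) z = rip x z + rip y z.
Proof. by rewrite /rip linearDl raddfD. Qed.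

Lemma ripDr x y z : rip z (x + y) = rip z x + rip z y.
Proof. by rewrite ripC ripDl !(ripC z). Qed.

Lemma ripNl x z : rip (- x) z = - rip x z.
Proof. by rewrite /rip linearNl raddfN. Qed.

Lemma ripNr x z : rip z (- x) = - rip z x.
Proof. by rewrite ripC ripNl ripC. Qed.

Lemma ripBl x y z : rip (x - y) z = rip x z - rip y z.
Proof. by rewrite ripDl ripNl. Qed.

Lemma rip0l z : rip 0 z = 0.
Proof. by rewrite /rip linear0l. Qed.

Lemma ripZl t x z : rip (t%:C%C *: x) z = t * rip x z.
Proof.
by rewrite /rip linearZl_LR/=; case: (inner x z) => p q /=; rewrite mul0r subr0.
Qed.

Lemma ripZr t x z : rip z (t%:C%C *: x) = t * rip z x.
Proof. by rewrite ripC ripZl ripC. Qed.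

Lemma rip_suml (I : Type) (s : seq I) (f : I -> H) z :
  rip (\sum_(i <- s) f i) z = \sum_(i <- s) rip (f i) z.
Proof. by rewrite /rip linear_sumlz raddf_sum. Qed.

Lemma nsqD x y : nsq (x + y) = nsq x + nsq y + 2 * rip x y.
Proof. rewrite -!rip_nsq ripDl !ripDr (ripC y x); lra. Qed.

Lemma nsqN x : nsq (- x) = nsq x.
Proof. by rewrite -!rip_nsq ripNl ripNr opprK. Qed.

Lemma nsqB x y : nsq (x - y) = nsq x + nsq y - 2 * rip x y.
Proof. rewrite nsqD nsqN ripNr; lra. Qed.

Lemma nsqZ t x : nsq (t%:C%C *: x) = t ^+ 2 * nsq x.
Proof. rewrite -!rip_nsq ripZl ripZr; lra. Qed.

Lemma rnormZ a x : rnorm (a *: x) = complex.Re `|a| * rnorm x.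
Proof.
rewrite /rnorm normrZ norm_rnorm normc_def /=; lra.
Qed.

Lemma nsqZc a x : nsq (a *: x) = (complex.Re `|a|) ^+ 2 * nsq x.
Proof. by rewrite /nsq rnormZ exprMn. Qed.

Lemma nsqD_le x y : nsq (x + y) <= 2 * nsq x + 2 * nsq y.
Proof. have := nsq_ge0 (x - y); rewrite nsqB nsqD; lra. Qed.

Lemma rip_le x y : 2 * rip x y <= nsq x + nsq y.
Proof. have := nsq_ge0 (x - y); rewrite nsqB; lra. Qed.

(** Cauchy-Schwarz inequality: [x] minus its component along [y] has a
nonnegative squared norm. *)
Lemma rip_sqr_le x y : rip x y ^+ 2 <= nsq x * nsq y.
Proof.
have [y0|y0] := eqVneq (nsq y) 0.
  by rewrite (nsq_eq0 y0) ripC rip0l expr0n/= mulr_ge0 ?nsq_ge0.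
have yp : 0 < nsq y by rewrite lt_def y0 nsq_ge0.
have := nsq_ge0 (x - (rip x y / nsq y)%:C%C *: y).
rewrite nsqB nsqZ ripZr => le0.
have : 0 <= nsq y * (nsq x + (rip x y / nsq y) ^+ 2 * nsq y -
   2 * (rip x y / nsq y * rip x y)) by rewrite mulr_ge0 ?nsq_ge0.
suff -> : nsq y * (nsq x + (rip x y / nsq y) ^+ 2 * nsq y -
   2 * (rip x y / nsq y * rip x y)) = nsq x * nsq y - rip x y ^+ 2 by lra.
by field.
Qed.

Lemma inner_rip x y : inner x y = ((rip x y)%:C + 'i * (rip x ('i *: y))%:C)%C.
Proof.
rewrite [LHS]complexE /rip; congr (_ + _ * _%:C)%C.
rewrite linearZr_LR/=; case: (inner x y) => p q/=; lra.
Qed.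

Lemma rip_i x : rip x ('i%C *: x) = 0.
Proof. by rewrite /rip linearZr_LR/= inner_nsq/=; lra. Qed.

Lemma inner_eq0 x y : (forall a, rip (a *: x) y = 0) -> inner x y = 0.
Proof.
move=> h0; have := h0 1; have := h0 'i%C; rewrite /rip scale1r linearZl_LR/=.
by case: (inner x y) => p q /= ? ->; congr Complex; lra.
Qed.

Lemma eq_inner x y : (forall z, inner z x = inner z y) -> x = y.
Proof.
move=> xy; apply/eqP; rewrite -subr_eq0; apply/eqP/nsq_eq0.
by rewrite -rip_nsq /rip linearBr/= xy subrr.
Qed.

End real_inner.

(** * Convergence in terms of the squared norm *)

Section convergence.
Context (R : realType) (H : hilbertType R).

(** The radii of the balls of [H] are positive elements of [R[i]], which are
automatically real; this is what reduces the topology of [H] to real estimates. *)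
Lemma gt0_real_complex (e : R[i]) : 0 < e -> exists2 t : R, 0 < t & e = t%:C%C.
Proof.
rewrite ltcE/= => /andP[/eqP i0 r0]; exists (complex.Re e) => //.
by case: e i0 r0 => p q/= ->.
Qed.

Lemma norm_lt (x : H) (t : R) : 0 < t -> (`|x| < t%:C%C) = (nsq x < t ^+ 2).
Proof.
by move=> t0; rewrite norm_rnorm ltcR ltr_pXn2r// nnegrE ?rnorm_ge0// ltW.
Qed.

Lemma cvg_nsqP (T : Type) (F : set_system T) {FF : Filter F} (u : T -> H) l :
  u @ F --> l <-> forall e : R, 0 < e -> \forall t \near F, nsq (l - u t) < e.
Proof.
split=> [/cvgrPdist_lt ul e e0|ul].
  have s0 : 0 < Num.sqrt e by rewrite sqrtr_gt0.
  have /ul : 0 < (Num.sqrt e)%:C%C by rewrite ltcR.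
  by apply: filterS => t; rewrite norm_lt// sqr_sqrtr// ltW.
apply/cvgrPdist_lt => e /gt0_real_complex[t t0 ->].
have /ul : 0 < t ^+ 2 by rewrite exprn_gt0.
by apply: filterS => s; rewrite norm_lt.
Qed.

Lemma cvg_rip (T : Type) (F : set_system T) {FF : Filter F} (u : T -> H) l v :
  u @ F --> l -> rip (u t) v @[t --> F] --> rip l v.
Proof.
move=> /cvg_nsqP ul; apply/cvgrPdist_lt => e e0.
have d0 : 0 < e ^+ 2 / (1 + nsq v).
  by rewrite divr_gt0 ?exprn_gt0 ?ltr_pwDl ?nsq_ge0.
apply: filterS (ul _ d0) => t; rewrite ltr_pdivlMr ?ltr_pwDl ?nsq_ge0// => lt.
rewrite -ripBl -(@ltr_pXn2r _ 2)// ?nnegrE ?ltW//.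
rewrite real_normK ?num_real// (le_lt_trans (rip_sqr_le _ _))//.
rewrite (le_lt_trans _ lt)// ler_wpM2l ?nsq_ge0//; lra.
Qed.

Lemma nsq_cauchy (T : Type) (F : set_system T) {FF : ProperFilter F} (u : T -> H) :
  (forall e : R, 0 < e -> exists2 A : set T, F A &
     forall s t, A s -> A t -> nsq (u s - u t) < e) ->
  exists l : H, u @ F --> l.
Proof.
move=> cu.
suff /cauchy_cvg/cvg_ex : cauchy (u @ F) by [].
apply/cauchy_ballP => e /gt0_real_complex[t t0 ->].
have [A FA Ae] : exists2 A : set T, F A &
     forall s r, A s -> A r -> nsq (u s - u r) < t ^+ 2.
  by apply: cu; rewrite exprn_gt0.
exists (u @` A, u @` A) => /=.
  by split; apply: (@filterS _ F _ A) => // x Ax; exists x.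
move=> [_ _]/= [[x Ax <-] [y By <-]].
by rewrite -ball_normE/= norm_lt//; exact: Ae.
Qed.

Lemma closed_nsq (S : set H) :
  (forall h, (forall e : R, 0 < e -> exists2 g, S g & nsq (h - g) < e) -> S h) ->
  closed S.
Proof.
move=> hS; apply/closure_id/seteqP; split; first exact: subset_closure.
move=> h; rewrite closureEnbhs => Sh; apply: hS => e e0.
have nb : nbhs h [set g | nsq (h - g) < e].
  have /cvg_nsqP := @cvg_id _ (nbhs h); exact.
by have [g [Sg ?]] := Sh S _ (fun _ => id) nb; exists g.
Qed.

End convergence.

(** * Riesz representation, adjoints and projections *)

Section riesz.
Context (R : realType) (H : hilbertType R).

(** The hypothesis says that the functional [J x = nsq x - 2 Re (f x)] is bounded
below.  By the parallelogram identity every minimizing sequence of [J] is Cauchy,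
and at its limit [p] the first-order condition is [Re (f w) = rip p w].  Taking
real parts at [x] and at ['i *: x] gives [f x = inner x p]. *)
Theorem riesz (f : H -> R[i]) (C : R) : scalar f ->
  (forall x, 2 * complex.Re (f x) <= nsq x + C) ->
  exists z, forall x, f x = inner x z.
Proof.
move=> flin fC.
have fD x y : f (x + y) = f x + f y by rewrite -[x]scale1r flin mul1r scale1r.
have f0 : f 0 = 0 by apply: (addrI (f 0)); rewrite -fD !addr0.
have fZ a x : f (a *: x) = a * f x by rewrite -[a *: x]addr0 flin f0 addr0.
pose J x := nsq x - 2 * complex.Re (f x).
pose E := range J.
have Elb : has_lbound E by exists (- C) => _ [x _ <-]; rewrite /J; have := fC x; lra.
have Einf : has_inf E by split => //; exists (J 0), 0.
have Jd x : inf E <= J x by apply: ge_inf => //; exists x.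
have Rfh (t : R) x : complex.Re (f (t%:C%C *: x)) = t * complex.Re (f x).
  by rewrite fZ; case: (f x) => p q /=; rewrite mul0r subr0.
have Jmid x y : nsq (x - y) <= 2 * (J x + J y - 2 * inf E).
  have := Jd ((2^-1 : R)%:C%C *: (x + y)).
  by rewrite /J nsqZ Rfh fD raddfD/= nsqD nsqB; lra.
have /choice[u uJ] n : exists x, J x < inf E + n.+1%:R^-1.
  have [|_ [x _ <-] ?] := @inf_adherent _ E n.+1%:R^-1 _ Einf; last by exists x.
  by rewrite invr_gt0.
have ue (e : R) : 0 < e -> \forall n \near \oo, J (u n) < inf E + e.
  move=> e0; have := near_infty_natSinv_lt (PosNum e0).
  apply: filterS => n /= ne; apply: lt_trans (uJ n) _.
  by rewrite ltrD2l.
have [p up] : exists p : H, u @ \oo --> p.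
  apply: nsq_cauchy => e e0.
  have e4 : 0 < e / 4 by rewrite divr_gt0.
  exists [set n | J (u n) < inf E + e / 4]; first exact: ue.
  by move=> m n /= Jm Jn; have := Jmid (u m) (u n); lra.
(* Only the values of J near its infimum and the continuity of rip in its first
   argument enter here, so that J is never evaluated at the limit p. *)
have gle w : complex.Re (f w) - rip p w <= nsq w / 2.
  apply/ler_addgt0Pr => e e0.
  suff : complex.Re (f w) - nsq w / 2 - e <= rip p w by lra.
  apply: (cvgr_to_ge (cvg_rip (v := w) up)).
  apply: filterS (ue _ e0) => n.
  by have := Jd (u n + w); rewrite /J nsqD fD raddfD/=; lra.
have g0 w : complex.Re (f w) = rip p w.
  pose g := complex.Re (f w) - rip p w.
  suff : g = 0 by rewrite /g; lra.
  (* gle has a linear left-hand side and a quadratic right-hand side; this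
     multiple of w makes the former dominate unless g = 0. *)
  have N1 : 0 < nsq w + 1 by rewrite ltr_wpDl ?nsq_ge0.
  have := gle ((g / (nsq w + 1))%:C%C *: w); rewrite Rfh ripZr nsqZ -mulrBr -/g.
  rewrite expr_div_n -(ler_pM2r (exprn_gt0 2 N1)).
  have -> : g / (nsq w + 1) * g * (nsq w + 1) ^+ 2 = g ^+ 2 * (nsq w + 1).
    by field; rewrite gt_eqF.
  have -> : g ^+ 2 / (nsq w + 1) ^+ 2 * nsq w / 2 * (nsq w + 1) ^+ 2 =
     g ^+ 2 * (nsq w / 2) by field; rewrite gt_eqF.
  rewrite -subr_le0 -mulrBr => le0; apply/eqP; rewrite -sqrf_eq0 eq_le sqr_ge0.
  rewrite andbT; move: le0; rewrite pmulr_lle0//; have := nsq_ge0 w; lra.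
exists p => x.
have := g0 ('i%C *: x); have := g0 x; rewrite (ripC p x) (ripC p) /rip fZ linearZl_LR/=.
case: (f x) (inner x p) => [a b] [c d]/= -> ?; congr Complex; lra.
Qed.

End riesz.

Section adjoint_theory.
Context (R : realType).
Implicit Types H K L : hilbertType R.

(** [adjoint] is a choice that is meaningful only when a Riesz vector exists; this
relation lets adjoints of plain functions, such as products along words, be
identified without any boundedness proof. *)
Definition is_adjoint H K (f : H -> K) (g : K -> H) :=
  forall x y, inner (f x) y = inner x (g y).

Lemma is_adjoint_unique H K (f : H -> K) g : is_adjoint f g -> adjoint f = g.
Proof.
move=> fg; apply/funext => y.
have : [set z : H | forall x : H, inner (f x) y = inner x z] (adjoint f y).
  by apply: getPex; exists (g y) => x; exact: fg.
by move=> /= h; apply: eq_inner => x; rewrite -h fg.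
Qed.

Lemma is_adjoint_comp H K L (f : K -> L) (g : H -> K) f' g' :
  is_adjoint f f' -> is_adjoint g g' -> is_adjoint (f \o g) (g' \o f').
Proof. by move=> ff' gg' x y /=; rewrite ff' gg'. Qed.

(** The bound of a bounded operator is an arbitrary element of [R[i]]; its norm is
a real bound, because the products that it has to dominate are nonnegative. *)
Lemma bop_nsq H K (f : bounded_op H K) :
  exists2 C : R, 0 < C & forall h, nsq (f h) <= C * nsq h.
Proof.
have [M fM] := bop_bounded f.
pose m := complex.Re `|M|.
have m0 : 0 <= m by rewrite -ler0c /m RRe_real ?normr_real.
exists (m ^+ 2 + 1); first by rewrite ltr_wpDl ?sqr_ge0.
move=> h.
have : rnorm (f h) <= m * rnorm h.
  rewrite -lecR rmorphM/= -!norm_rnorm /m RRe_real ?normr_real//.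
  apply: (le_trans (fM h)); rewrite -[leLHS]ger0_norm ?normrM ?normr_id//.
  by apply: le_trans (fM h).
move=> fh; apply: (@le_trans _ _ ((m * rnorm h) ^+ 2)).
  by rewrite ler_sqr ?nnegrE ?mulr_ge0 ?rnorm_ge0.
by rewrite exprMn ler_wpM2r ?nsq_ge0// lerDl.
Qed.

(** If [nsq (f x) <= D * nsq x], expanding [0 <= nsq (f x - D *: y)] gives
[2 * rip (f x) y <= nsq x + D * nsq y], the lower bound that [riesz] requires. *)
Lemma adjointP H K (f : bounded_op H K) : is_adjoint f (adjoint f).
Proof.
move=> + y; apply: (getPex (P := [set z : H | forall x, inner (f x) y = inner x z])).
have [D D0 fD] := bop_nsq f.
apply: (@riesz _ _ (fun x => inner (f x) y) (D * nsq y)).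
  by move=> a u v /=; rewrite linearP linearPl.
move=> x; rewrite -/(rip _ _).
have := nsq_ge0 (f x - D%:C%C *: y); rewrite nsqB nsqZ ripZr => le0.
have := fD x => le1; rewrite -(ler_pM2l D0); nra.
Qed.

Lemma adj_rip H K (f : bounded_op H K) x y :
  rip (f x) y = rip x (adjoint f y).
Proof. by rewrite /rip adjointP. Qed.

End adjoint_theory.

Section bounded_operators.
Context (R : realType).
Implicit Types H K : hilbertType R.

Lemma bound_of_nsq H K (f : H -> K) :
  (exists C : R, forall h, nsq (f h) <= C * nsq h) ->
  exists M : R[i], forall h, `|f h| <= M * `|h|.
Proof.
case=> C fC; exists (`|C| + 1)%:C%C => h.
rewrite !norm_rnorm -rmorphM/= lecR.
have C1 : 0 <= `|C| + 1 by rewrite addr_ge0.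
rewrite -ler_sqr ?nnegrE ?mulr_ge0 ?rnorm_ge0// exprMn -!/(nsq _).
apply: (le_trans (fC h)); rewrite ler_wpM2r ?nsq_ge0//.
apply: (le_trans (ler_norm C)); have := normr_ge0 C; nra.
Qed.

Definition mk_bop H K (f : H -> K) (flin : linear f)
    (fC : exists C : R, forall h, nsq (f h) <= C * nsq h) : bounded_op H K :=
  @BoundedOp _ _ _ (HB.pack f (GRing.isLinear.Build _ _ _ _ f flin))
    (bound_of_nsq fC).

Lemma is_adjoint_linear H K (f : H -> K) g : is_adjoint f g -> linear g.
Proof.
by move=> fg a x y; apply: eq_inner => z; rewrite linearPr/= -!fg linearPr.
Qed.

Lemma is_adjointZ H K (f : H -> K) g a y : is_adjoint f g -> g (a *: y) = a *: g y.
Proof. by move=> fg; apply: eq_inner => z; rewrite linearZr_LR/= -!fg linearZr_LR. Qed.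

End bounded_operators.

Section projection.
Context (R : realType) (H : hilbertType R) (M : closed_subspace H).

Lemma csub_val_linear : linear (@csub_val R H M).
Proof. by []. Qed.

Lemma nsq_csub_val (x : M) : nsq (csub_val x) = nsq x.
Proof. by []. Qed.

Lemma csub_val_in (x : M) : csub_set M (csub_val x).
Proof. by have := csub_valP x; rewrite inE. Qed.

Lemma csub_val_bounded :
  exists C : R, forall x : M, nsq (csub_val x) <= C * nsq x.
Proof. by exists 1 => x; rewrite mul1r. Qed.

Definition csub_incl : bounded_op M H := mk_bop csub_val_linear csub_val_bounded.

(** The adjoint of the inclusion of [M] is the orthogonal projection onto [M], so
that its existence is Riesz's theorem in the Hilbert space [M]. *)
Definition oproj : H -> M := adjoint csub_incl.

Lemma csub_incl_oproj : is_adjoint csub_incl oproj.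
Proof. exact: adjointP. Qed.

Lemma oproj_linear : linear oproj.
Proof. exact: is_adjoint_linear csub_incl_oproj. Qed.

Lemma nsq_oproj_le h : nsq (oproj h) <= nsq h.
Proof.
have := rip_le (csub_incl (oproj h)) h.
by rewrite adj_rip -/(oproj h) rip_nsq [nsq (csub_incl _)]nsq_csub_val; lra.
Qed.

End projection.

(** * Row contractions as families of finite inequalities *)

Section finite_sums.
Variables (I : choiceType).

Lemma big_fsetD_sub (V : nmodType) (F G : {fset I}) (f : I -> V) : (F `<=` G)%fset ->
  \sum_(i <- G) f i = \sum_(i <- F) f i + \sum_(i <- (G `\` F)%fset) f i.
Proof.
move=> FG; rewrite (big_fsetID _ (mem F))/=; congr (_ + _).
  congr (\sum_(i <- enum_fset _) _); apply/fsetP => i; rewrite !inE/= andbC.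
  by have [iF|//] := boolP (i \in F); rewrite (fsubsetP FG).
by congr (\sum_(i <- enum_fset _) _); apply/fsetP => i; rewrite !inE/= andbC.
Qed.

Lemma ler_sum_fset (R : realDomainType) (F G : {fset I}) (f : I -> R) :
  (F `<=` G)%fset -> (forall i, 0 <= f i) ->
  \sum_(i <- F) f i <= \sum_(i <- G) f i.
Proof. by move=> FG f0; rewrite (big_fsetD_sub _ FG) lerDl sumr_ge0. Qed.

Lemma esum_leP (R : realType) (a : I -> \bar R) c :
  (\esum_(i in [set: I]) a i <= c)%E <->
  forall F : {fset I}, (\sum_(i <- F) a i <= c)%E.
Proof.
split=> [ac F|aF].
  apply: le_trans ac; apply: esum_ge; exists [set` F]; first by split.
  by rewrite -fsbig_seq.
by apply: ge_ereal_sup => _ [X [finX _] <-]; rewrite fsbig_finite.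
Qed.

End finite_sums.

#[local] Existing Instance summability.totally_filter.

Section row_contractions.
Context (R : realType) (H : hilbertType R) (I : choiceType).
Context (T : I -> bounded_op H H).

(** This is the condition that the column of the adjoints is a contraction.  It is
equivalent to [row_contraction T] ([row_contraction_bound] and
[row_bound_contraction]), and it mentions neither the strong sum nor its
limit. *)
Definition row_bound := forall h (F : {fset I}),
  \sum_(i <- F) nsq (adjoint (T i) h) <= nsq h.

Lemma partial_sumE (f : I -> H) (F : {fset I}) :
  summability.partial_sum f F = \sum_(i <- F) f i.
Proof. by rewrite [RHS]big_seq_fsetE. Qed.

Lemma partial_sum_rip (h v : H) (F : {fset I}) :
  rip (summability.partial_sum (fun i => T i (adjoint (T i) h)) F) v =
  \sum_(i <- F) rip (adjoint (T i) h) (adjoint (T i) v).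
Proof.
by rewrite partial_sumE rip_suml; apply: eq_bigr => i _; rewrite adj_rip.
Qed.

Lemma row_contraction_bound : row_contraction T -> row_bound.
Proof.
case=> S cS Sle h F.
have Sh : rip (S h) h <= nsq h.
  by have := Sle h; rewrite lecE inner_nsq => /andP[].
apply: le_trans Sh; apply: (cvgr_to_ge (cvg_rip (v := h) (cS h))).
have : summability.totally [set G | (F `<=` G)%fset] by exists F.
apply: filterS => G /= FG; rewrite partial_sum_rip.
rewrite [leRHS](eq_bigr _ (fun i _ => rip_nsq _)).
by apply: ler_sum_fset => // i; exact: nsq_ge0.
Qed.

Hypothesis Tb : row_bound.

(** The row operator is the adjoint of the column of the [T_i^*], so it is a
contraction as well.  With [v] the left-hand sum, [2 * rip v v] is a sum of terms
[2 * rip (y i) (T_i^* v)], which are bounded by [rip_le] and [row_bound]. *)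
Lemma nsq_row_le (y : I -> H) (F : {fset I}) :
  nsq (\sum_(i <- F) T i (y i)) <= \sum_(i <- F) nsq (y i).
Proof.
set v := \sum_(i <- F) _.
have : 2 * rip v v <= \sum_(i <- F) nsq (y i) + nsq v.
  rewrite {1}/v rip_suml mulr_sumr.
  apply: (@le_trans _ _ (\sum_(i <- F) (nsq (y i) + nsq (adjoint (T i) v)))).
    by apply: ler_sum => i _; rewrite adj_rip rip_le.
  by rewrite big_split/= lerD2l.
rewrite rip_nsq; lra.
Qed.

(** By [nsq_row_le] the partial sums of [T i (y i)] inherit the Cauchy property
from the bounded increasing sums of [nsq (y i)]. *)
Lemma row_sum_cvg (y : I -> H) (C : R) :
  (forall F : {fset I}, \sum_(i <- F) nsq (y i) <= C) ->
  exists l : H, summability.partial_sum (fun i => T i (y i)) @ summability.totally --> l.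
Proof.
move=> yC; apply: nsq_cauchy => e e0.
pose E := [set \sum_(i <- F : {fset I}) nsq (y i) | F in [set: {fset I}]].
have Es : has_sup E.
  split; first by exists (\sum_(i <- (fset0 : {fset I})) nsq (y i)), fset0.
  by exists C => _ [F _ <-].
have e4 : 0 < e / 4 by rewrite divr_gt0.
have [_ [F _ <-] Fe] := sup_adherent e4 Es.
have near_F G : (F `<=` G)%fset ->
    nsq (\sum_(i <- G) T i (y i) - \sum_(i <- F) T i (y i)) < e / 4.
  move=> FG; rewrite (big_fsetD_sub _ FG) addrC addKr.
  apply: le_lt_trans (nsq_row_le _ _) _.
  have : \sum_(i <- G) nsq (y i) <= sup E by apply: sup_ubound; [case: Es|exists G].
  rewrite (big_fsetD_sub _ FG); lra.
exists [set G | (F `<=` G)%fset]; first by exists F.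
move=> G G' /= /near_F Ge /near_F Ge'; rewrite !partial_sumE.
set s := \sum_(i <- F) _ in Ge Ge'.
have := nsqD_le (\sum_(i <- G) T i (y i) - s) (s - \sum_(i <- G') T i (y i)).
rewrite addrA subrK -(nsqN (s - _)) opprB; lra.
Qed.

(** The sum of [T_i T_i^*] converges strongly by [row_sum_cvg]; linearity, the norm
bound and the inequality with the identity all pass to the limit from finite
sums. *)
Lemma row_bound_contraction : row_contraction T.
Proof.
have /choice[S cS] h : exists l : H,
    summability.partial_sum (fun i => T i (adjoint (T i) h))
      @ summability.totally --> l.
  exact: row_sum_cvg (Tb h).
have Slin : linear S.
  move=> a x y; have := cS (a *: x + y).
  rewrite (_ : summability.partial_sum _ = fun F =>
      a *: summability.partial_sum (fun i => T i (adjoint (T i) x)) F +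
      summability.partial_sum (fun i => T i (adjoint (T i) y)) F).
    by move=> cE; exact: norm_cvg_unique cE (cvgD (cvgZ (cvg_cst a) (cS x)) (cS y)).
  apply/funext => F; rewrite !partial_sumE scaler_sumr -big_split/=.
  by apply: eq_bigr => i _; rewrite (is_adjoint_linear (adjointP (T i))) linearP.
have Snsq : exists C : R, forall h, nsq (S h) <= C * nsq h.
  exists 1 => h.
  have : rip (S h) (S h) <= (nsq h + nsq (S h)) / 2.
    apply: (cvgr_to_le (cvg_rip (v := S h) (cS h))); apply: nearW => F.
    rewrite partial_sum_rip -(ler_pM2l (ltr0Sn _ 1)) mulr_sumr mulrC divfK//.
    apply: (@le_trans _ _ (\sum_(i <- F)
       (nsq (adjoint (T i) h) + nsq (adjoint (T i) (S h))))).
      by apply: ler_sum => i _; exact: rip_le.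
    by rewrite big_split/= lerD.
  rewrite rip_nsq; lra.
exists (mk_bop Slin Snsq); first exact: cS.
move=> h /=; rewrite [leLHS]inner_rip inner_nsq.
(* Comparing inner products in R[i] also requires that inner (S h) h be real. *)
have -> : rip (S h) ('i%C *: h) = 0.
  apply: (cvg_unique (@Rhausdorff R) (cvg_rip (v := 'i%C *: h) (cS h))).
  apply: cvg_near_cst; apply: nearW => F; rewrite partial_sum_rip big1// => i _.
  by rewrite (is_adjointZ _ _ (adjointP (T i))) rip_i.
rewrite mulr0 addr0 lecR.
apply: (cvgr_to_le (cvg_rip (v := h) (cS h))); apply: nearW => F.
by rewrite partial_sum_rip [leLHS](eq_bigr _ (fun i _ => rip_nsq _)).
Qed.

End row_contractions.

(** * Sums over letters and over words *)

Section esum_complements.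
Context (R : realType) (I : choiceType).
Local Open Scope ereal_scope.

Lemma esumZl_le (S : set I) (c : R) (a : I -> \bar R) :
  (0 <= c)%R -> (forall i, 0 <= a i) ->
  \esum_(i in S) (c%:E * a i) <= c%:E * \esum_(i in S) a i.
Proof.
move=> c0 a0; apply: ge_ereal_sup => _ [X [finX XS] <-].
rewrite fsbig_finite//= -ge0_sume_distrr// lee_wpmul2l ?lee_fin//.
by apply: esum_ge; exists X => //; rewrite fsbig_finite.
Qed.

(** A reverse Fatou inequality for decreasing summable families.  A finite set [X]
carries the sum at index 0 up to [e], and the tails outside [X] stay below [e] at
all later indices; on [X] the infimum and the finite sum commute. *)
Lemma esum_inf_le (a : I -> nat -> \bar R) :
  (forall i k, 0 <= a i k) ->
  (forall i, {homo a i : n m / (n <= m)%N >-> m <= n}) ->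
  \esum_(i in [set: I]) a i 0%N \is a fin_num ->
  ereal_inf (range (fun k => \esum_(i in [set: I]) a i k)) <=
  \esum_(i in [set: I]) ereal_inf (range (a i)).
Proof.
move=> a0 adec afin; apply/lee_addgt0Pr => e e0.
have [_ [X [finX _] <-] Xe] := ub_ereal_sup_adherent e0 afin.
have split_sum k : \esum_(i in [set: I]) a i k =
    \sum_(i <- fset_set X) a i k + \esum_(i in [set: I] `&` ~` X) a i k.
  by rewrite (esumID X)// setTI esum_fset// fsbig_finite.
have tail : \esum_(i in [set: I] `&` ~` X) a i 0%N <= e%:E.
  move: Xe; rewrite -/(esum _ _) fsbig_finite//.
  move: afin; rewrite split_sum fin_numD => /andP[Afin Bfin].
  by rewrite lteBlDr// lteD2lE// => /ltW.
have inf0 i : 0 <= ereal_inf (range (a i)).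
  by apply: le_ereal_inf_tmp => _ [k _ <-].
apply: (@le_trans _ _ (\sum_(i <- fset_set X) ereal_inf (range (a i)) + e%:E)).
  rewrite -leeBlDr//.
  have cX : (\sum_(i <- fset_set X) a i k)%R @[k --> \oo] -->
      \sum_(i <- fset_set X) ereal_inf (range (a i)).
    apply: cvg_nnesum => [i _|i _]; first exact: nearW.
    exact: (ereal_nonincreasing_cvgn (adec i)).
  apply: (lee_cvg_to (@cvg_cst _ _ _ \oo _) cX); apply: nearW => k.
  rewrite leeBlDr//.
  apply: (@le_trans _ _ (\esum_(i in [set: I]) a i k)).
    by apply: ereal_inf_lbound; exists k.
  rewrite split_sum leeD2l//.
  by apply: le_trans tail; apply: le_esum => i _; exact: adec.
rewrite leeD2r//; apply: esum_ge; exists X; first by split.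
by rewrite fsbig_finite.
Qed.

Lemma esum_words0 (F : seq I -> \bar R) : 0 <= F [::] ->
  \esum_(s in [set s | size s = 0%N]) F s = F [::].
Proof.
move=> F0; rewrite (_ : [set _ | _] = [set [::]]) ?esum_set1//.
by apply/seteqP; split=> s /= => [/size0nil|->].
Qed.

Lemma esum_wordsS (F : seq I -> \bar R) k : (forall s, 0 <= F s) ->
  \esum_(s in [set s | size s = k.+1]) F s =
  \esum_(i in [set: I]) \esum_(s in [set s | size s = k]) F (i :: s).
Proof.
move=> F0; rewrite esum_esum// -(esum_image _ (fun p => p.1 :: p.2)).
  congr esum; apply/seteqP; split=> [[|i s]//= [sk]|_ [[i s] [_ /= <-] <-]//].
  by exists (i, s).
by move=> [i s] [j t] _ _ /= [-> ->].
Qed.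

End esum_complements.

(** * The limit of the word sums *)

Section word_sums.
Context (R : realType) (H : hilbertType R) (I : choiceType).
Context (T : I -> bounded_op H H).
Implicit Types (h x y : H) (k : nat).
Local Open Scope ereal_scope.

(** The first letter of the word acts first because taking adjoints reverses
products: [(T_i T_s)^* = T_s^* T_i^*]. *)
Fixpoint adjoint_word (s : seq I) (h : H) : H :=
  if s is i :: s' then adjoint_word s' (adjoint (T i) h) else h.

Lemma word_op_adjoint s : is_adjoint (word_op T s) (adjoint_word s).
Proof.
elim: s => [|i s IH]; first by [].
exact: (is_adjoint_comp (adjointP (T i)) IH).
Qed.

Lemma word_sumE h k : word_sum T h k =
  \esum_(s in [set s | size s = k]) (nsq (adjoint_word s h))%:E.
Proof.
by apply: eq_esum => s _; rewrite (is_adjoint_unique (word_op_adjoint s)).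
Qed.

Lemma word_sum0 h : word_sum T h 0%N = (nsq h)%:E.
Proof. by rewrite word_sumE esum_words0//= lee_fin nsq_ge0. Qed.

(** Splitting off the first letter of a word; the facts below about words of
arbitrary length follow from this identity by induction, each needing only an
estimate for a single letter. *)
Lemma word_sumS h k :
  word_sum T h k.+1 = \esum_(i in [set: I]) word_sum T (adjoint (T i) h) k.
Proof.
rewrite word_sumE esum_wordsS; last by move=> s; rewrite lee_fin nsq_ge0.
by apply: eq_esum => i _; rewrite word_sumE.
Qed.

Lemma word_sum_ge0 h k : 0 <= word_sum T h k.
Proof. by apply: esum_ge0 => s _; rewrite lee_fin sqr_ge0. Qed.

Hypothesis Tb : row_bound T.

Lemma esum_row_bound h :
  \esum_(i in [set: I]) (nsq (adjoint (T i) h))%:E <= (nsq h)%:E.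
Proof. by apply/esum_leP => F; rewrite sumEFin lee_fin. Qed.

Lemma word_sum_decr h : {homo word_sum T h : n m / (n <= m)%N >-> m <= n}.
Proof.
suff step k x : word_sum T x k.+1 <= word_sum T x k.
  move=> n; elim=> [|m IH]; first by rewrite leqn0 => /eqP ->.
  by rewrite leq_eqVlt ltnS => /predU1P[->//|/IH]; apply: le_trans.
elim: k x => [|k IH] x; last by rewrite 2!word_sumS le_esum.
rewrite word_sumS word_sum0; apply: le_trans (esum_row_bound x).
by apply: le_esum => i _; rewrite word_sum0.
Qed.

Lemma word_sum_le h k : word_sum T h k <= (nsq h)%:E.
Proof. by rewrite -word_sum0 word_sum_decr. Qed.

(** As an infimum, this is the limit of the word sums only because they decrease
([word_sum_cvg]). *)
Definition word_lim h : \bar R := ereal_inf (range (word_sum T h)).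

Lemma word_sum_cvg h : word_sum T h @ \oo --> word_lim h.
Proof. exact/ereal_nonincreasing_cvgn/word_sum_decr. Qed.

Lemma word_lim_ge0 h : 0 <= word_lim h.
Proof. by apply: le_ereal_inf_tmp => _ [k _ <-]; exact: word_sum_ge0. Qed.

Lemma word_lim_le h k : word_lim h <= word_sum T h k.
Proof. by apply: ereal_inf_lbound; exists k. Qed.

Lemma word_lim_nsq h : word_lim h <= (nsq h)%:E.
Proof. by rewrite -word_sum0 word_lim_le. Qed.

Lemma word_lim_fin h : word_lim h \is a fin_num.
Proof. by rewrite ge0_fin_numE ?word_lim_ge0// (le_lt_trans (word_lim_nsq h)) ?ltry. Qed.

Lemma word_sum_lin (a : R[i]) x y k : word_sum T (a *: x + y)%R k <=
  (2 * complex.Re `|a| ^+ 2)%:E * word_sum T x k + 2%:E * word_sum T y k.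
Proof.
have nsq0 z : 0 <= (nsq z)%:E by rewrite lee_fin nsq_ge0.
rewrite !word_sumE; set c := (2 * _)%R.
have c0 : (0 <= c)%R by rewrite mulr_ge0 ?sqr_ge0.
apply: (@le_trans _ _ (\esum_(s in [set s | size s = k])
   (c%:E * (nsq (adjoint_word s x))%:E + 2%:E * (nsq (adjoint_word s y))%:E))).
  apply: le_esum => s _; rewrite -!EFinM -EFinD lee_fin.
  rewrite (is_adjoint_linear (word_op_adjoint s)).
  by apply: (le_trans (nsqD_le _ _)); rewrite nsqZc mulrA.
rewrite esumD; try by move=> i _; rewrite mule_ge0.
by rewrite leeD// esumZl_le.
Qed.

Lemma word_lim_lin (a : R[i]) x y : word_lim (a *: x + y)%R <=
  (2 * complex.Re `|a| ^+ 2)%:E * word_lim x + 2%:E * word_lim y.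
Proof.
have cvg_rhs : (fun k => (2 * complex.Re `|a| ^+ 2)%:E * word_sum T x k +
    2%:E * word_sum T y k) @ \oo -->
    (2 * complex.Re `|a| ^+ 2)%:E * word_lim x + 2%:E * word_lim y.
  apply: cvgeD.
  - by rewrite fin_num_adde_defl// fin_numM// word_lim_fin.
  - by apply: cvgeZl => //; exact: word_sum_cvg.
  - by apply: cvgeZl => //; exact: word_sum_cvg.
apply: (lee_cvg_to (@word_sum_cvg _) cvg_rhs).
by apply: nearW => k; exact: word_sum_lin.
Qed.

Lemma word_limD x y : word_lim (x + y)%R <= 2%:E * word_lim x + 2%:E * word_lim y.
Proof.
have := word_lim_lin 1%R x y.
by rewrite scale1r normr1/= expr1n mulr1.
Qed.

(** The limit and the sum over the letters can be exchanged because the word sums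
of [T_i^* h] are dominated by [nsq (T_i^* h)], whose sum is at most [nsq h]. *)
Lemma word_lim_row h : word_lim h <= \esum_(i in [set: I]) word_lim (adjoint (T i) h).
Proof.
apply: (@le_trans _ _ (ereal_inf (range (fun k =>
   \esum_(i in [set: I]) word_sum T (adjoint (T i) h) k)))).
  by apply: le_ereal_inf_tmp => _ [k _ <-]; rewrite -word_sumS word_lim_le.
apply: (esum_inf_le (a := fun i => word_sum T (adjoint (T i) h))).
- by move=> i k; exact: word_sum_ge0.
- by move=> i; exact: word_sum_decr.
- rewrite -word_sumS ge0_fin_numE ?word_sum_ge0//.
  by rewrite (le_lt_trans (word_sum_le _ _)) ?ltry.
Qed.

Lemma word_lim_words h k :
  word_lim h <= \esum_(s in [set s | size s = k]) word_lim (adjoint_word s h).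
Proof.
elim: k h => [|k IH] h; first by rewrite esum_words0//= word_lim_ge0.
rewrite esum_wordsS; last by move=> s; exact: word_lim_ge0.
by apply: (le_trans (word_lim_row h)); apply: le_esum => i _; exact: IH.
Qed.

End word_sums.

(** * Orthogonal decompositions *)

Section orthogonal_complement.
Context (R : realType) (H : hilbertType R) (M : closed_subspace H).

Definition orthoc_set : set H := [set h | forall m, csub_set M m -> inner m h = 0].

Lemma orthoc0 : orthoc_set 0.
Proof. by move=> m _; rewrite linear0r. Qed.

Lemma orthocDZ (a : R[i]) (x y : H) :
  orthoc_set x -> orthoc_set y -> orthoc_set (a *: x + y).
Proof. by move=> xM yM m Mm; rewrite linearPr/= xM// yM// mulr0 addr0. Qed.

(** For [g] in the complement close to [h] and [m] in [M], Cauchy-Schwarz bounds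
[rip m h = rip m (h - g)]. *)
Lemma orthoc_closed : closed orthoc_set.
Proof.
apply: closed_nsq => h hM m Mm; apply: inner_eq0 => a.
have Mam : csub_set M (a *: m).
  by rewrite -[_ *: _]addr0; apply: csubDZ => //; exact: csub0.
apply/eqP; rewrite -sqrf_eq0 eq_le sqr_ge0 andbT; apply/ler_addgt0Pr => e e0.
have N1 : 0 < nsq (a *: m) + 1 by rewrite ltr_wpDl ?nsq_ge0.
have [g gM ge] := hM _ (divr_gt0 e0 N1).
have -> : rip (a *: m) h = rip (a *: m) (h - g).
  by rewrite ripDr ripNr [X in _ - X]/rip gM// subr0.
rewrite add0r (le_trans (rip_sqr_le _ _))//.
move: ge; rewrite ltr_pdivlMr// => /ltW; apply: le_trans.
by rewrite mulrC ler_wpM2l ?nsq_ge0// lerDl.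
Qed.

Definition orthoc : closed_subspace H :=
  ClosedSubspace orthoc0 orthocDZ orthoc_closed.

Lemma csub_val_CSub h (hM : csub_set M h) : csub_val (CSub (mem_set hM)) = h.
Proof. by []. Qed.

Lemma oproj_id h : csub_set M h -> csub_val (oproj M h) = h.
Proof.
move=> hM; rewrite -(csub_val_CSub hM); congr csub_val.
by apply: eq_inner => z; rewrite -csub_incl_oproj.
Qed.

Lemma oproj_val (x : M) : oproj M (csub_val x) = x.
Proof. by apply: val_inj; apply: oproj_id; exact: csub_val_in. Qed.

Lemma oprojD x y : oproj M (x + y) = oproj M x + oproj M y.
Proof. by rewrite -[x]scale1r oproj_linear !scale1r. Qed.

Lemma oproj_eq0 h : (forall x : M, inner (csub_val x) h = 0) -> oproj M h = 0.
Proof. by move=> h0; apply: eq_inner => z; rewrite -csub_incl_oproj h0 linear0r. Qed.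

Lemma orthoc_sub_oproj h : orthoc_set (h - csub_val (oproj M h)).
Proof.
move=> m Mm; rewrite linearBr/= -(csub_val_CSub Mm).
by rewrite [X in X - _](csub_incl_oproj (CSub (mem_set Mm)) h) subrr.
Qed.

Lemma orthoc_decomposition : orthogonal_decomposition M orthoc.
Proof.
split=> [x0 x1|h]; first by apply: (csub_val_in x1); exact: csub_val_in.
exists (oproj M h), (CSub (mem_set (orthoc_sub_oproj h : csub_set orthoc _))) => /=.
by rewrite addrC subrK.
Qed.

End orthogonal_complement.

Section orthogonal_decompositions.
Context (R : realType) (H : hilbertType R) (K0 K1 : closed_subspace H).
Hypothesis K01 : orthogonal_decomposition K0 K1.

Lemma decomp_orth (x0 : K0) (x1 : K1) : inner (csub_val x0) (csub_val x1) = 0.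
Proof. by case: K01. Qed.

Lemma decomp_orthC (x0 : K0) (x1 : K1) : inner (csub_val x1) (csub_val x0) = 0.
Proof. by rewrite inner_conj decomp_orth conjC0. Qed.

Lemma oproj0_val1 (x1 : K1) : oproj K0 (csub_val x1) = 0.
Proof. by apply: oproj_eq0 => x; exact: decomp_orth. Qed.

Lemma oproj1_val0 (x0 : K0) : oproj K1 (csub_val x0) = 0.
Proof. by apply: oproj_eq0 => x; exact: decomp_orthC. Qed.

Lemma decompE h : h = csub_val (oproj K0 h) + csub_val (oproj K1 h).
Proof.
have [x0 [x1 ->]] := K01.2 h.
by rewrite !oprojD !oproj_val oproj0_val1 oproj1_val0 addr0 add0r.
Qed.

Lemma decomp_set1 : csub_set K1 = orthoc_set K0.
Proof.
apply/seteqP; split=> h hK.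
  by move=> m Km; rewrite -(csub_val_CSub Km) -(csub_val_CSub hK) decomp_orth.
rewrite (decompE h) oproj_eq0 ?add0r; first exact: csub_val_in.
by move=> x; apply: hK; exact: csub_val_in.
Qed.

End orthogonal_decompositions.

(** * Word sums of the diagonal blocks *)

Section block_form.
Context (R : realType) (H : hilbertType R) (I : choiceType).
Context (T : I -> bounded_op H H) (K0 K1 : closed_subspace H).
Hypothesis K01 : orthogonal_decomposition K0 K1.
Context (A : I -> bounded_op K0 K0) (X : I -> bounded_op K0 K1)
  (B : I -> bounded_op K1 K1).
Hypothesis TAB : forall i, has_lower_block_form (T i) (A i) (X i) (B i).
Hypothesis Tinv : forall i h, csub_set K0 h -> csub_set K0 (adjoint (T i) h).

Lemma block_val0 i x0 :
  T i (csub_val x0) = csub_val (A i x0) + csub_val (X i x0).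
Proof. by have := TAB i x0 0; rewrite linear0 !addr0. Qed.

Lemma block_val1 i x1 : T i (csub_val x1) = csub_val (B i x1).
Proof. by have := TAB i 0 x1; rewrite !linear0 !add0r. Qed.

Lemma block_adjoint0 i y : csub_val (adjoint (A i) y) = adjoint (T i) (csub_val y).
Proof.
rewrite (_ : adjoint (A i) = fun y => oproj K0 (adjoint (T i) (csub_val y))).
  by apply: oproj_id; apply: Tinv; exact: csub_val_in.
apply: is_adjoint_unique => x z; rewrite -csub_incl_oproj -adjointP block_val0.
by rewrite linearDl/= (decomp_orthC K01) addr0.
Qed.

(** Lower triangularity of [T_i] means that [T_i^*] leaves [K0] invariant, so the
component of [h] in [K0] contributes nothing to the right-hand side.  The
identity is stated for all [h] in [H] so that it can be iterated along words. *)
Lemma block_adjoint1 i h :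
  adjoint (B i) (oproj K1 h) = oproj K1 (adjoint (T i) h).
Proof.
have adjBE : adjoint (B i) = fun y => oproj K1 (adjoint (T i) (csub_val y)).
  apply: is_adjoint_unique => x z; rewrite -csub_incl_oproj -adjointP.
  by rewrite [csub_incl K1 x]/= block_val1.
rewrite adjBE [in RHS](decompE K01 h).
have -> u v : adjoint (T i) (u + v) = adjoint (T i) u + adjoint (T i) v.
  by rewrite -[u]scale1r (is_adjoint_linear (adjointP (T i))) !scale1r.
rewrite oprojD -[X in X + _](_ : 0 = _) ?add0r//.
rewrite -(csub_val_CSub (Tinv i (csub_val_in (oproj K0 h)))).
by rewrite (oproj1_val0 K01).
Qed.

Lemma block_adjoint_word0 s y :
  csub_val (adjoint_word A s y) = adjoint_word T s (csub_val y).
Proof. by elim: s y => //= i s IH y; rewrite IH block_adjoint0. Qed.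

Lemma block_adjoint_word1 s h :
  adjoint_word B s (oproj K1 h) = oproj K1 (adjoint_word T s h).
Proof. by elim: s h => //= i s IH h; rewrite block_adjoint1 IH. Qed.

Lemma block_word_sum0 y k : word_sum A y k = word_sum T (csub_val y) k.
Proof.
rewrite !word_sumE; apply: eq_esum => s _.
by rewrite -block_adjoint_word0.
Qed.

Lemma block_word_sum1 h k : (word_sum B (oproj K1 h) k <= word_sum T h k)%E.
Proof.
rewrite !word_sumE; apply: le_esum => s _.
by rewrite block_adjoint_word1 lee_fin nsq_oproj_le.
Qed.

Hypothesis Tb : row_bound T.

Lemma block_row_bound0 : row_bound A.
Proof.
move=> h F; apply: le_trans (Tb (csub_val h) F).
by apply: ler_sum => i _; rewrite -block_adjoint0.
Qed.

Lemma block_row_bound1 : row_bound B.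
Proof.
move=> h F; apply: le_trans (Tb (csub_val h) F).
apply: ler_sum => i _; rewrite -[h in leLHS]oproj_val block_adjoint1.
exact: nsq_oproj_le.
Qed.

Hypothesis K0lim : forall h, csub_set K0 h -> word_lim T h = 0%E.

(** Any vector [g] satisfies [word_lim T g <= 2 * nsq (oproj K1 g)], because its
component in [K0] is negligible.  Applying this at the end of every word of length
[k], and not at each letter, keeps the constant equal to 2 for all [k]. *)
Lemma block_word_lim h k :
  (word_lim T h <= 2%:E * word_sum B (oproj K1 h) k)%E.
Proof.
apply: (le_trans (word_lim_words Tb h k)); rewrite word_sumE.
apply: le_trans (esumZl_le _ _ _) => //; last first.
  by move=> s; rewrite lee_fin nsq_ge0.
apply: le_esum => s _; rewrite block_adjoint_word1.
set g := adjoint_word T s h.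
rewrite [in leLHS](decompE K01 g); apply: le_trans (word_limD Tb _ _) _.
rewrite K0lim ?mule0 ?add0e; last exact: csub_val_in.
by rewrite lee_wpmul2l// word_lim_nsq.
Qed.

End block_form.

(** * Existence and uniqueness of the triangulation *)

Section compression.
Context (R : realType) (H : hilbertType R) (M N : closed_subspace H).
Context (f : bounded_op H H).

Definition compress_fun (x : M) : N := oproj N (f (csub_val x)).

Lemma compress_linear : linear compress_fun.
Proof. by move=> a x y; rewrite /compress_fun/= linearP oproj_linear. Qed.

Lemma compress_bounded : exists C : R, forall x, nsq (compress_fun x) <= C * nsq x.
Proof.
have [C _ fC] := bop_nsq f; exists C => x.
exact: le_trans (nsq_oproj_le _ _) (fC _).
Qed.

Definition compress : bounded_op M N := mk_bop compress_linear compress_bounded.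

End compression.

Section vanishing_subspace.
Context (R : realType) (H : hilbertType R) (I : choiceType).
Context (T : I -> bounded_op H H).
Hypothesis Tb : row_bound T.

Definition vanishing_set : set H := [set h | word_lim T h = 0%E].

Lemma vanishing0 : vanishing_set 0.
Proof.
apply/eqP; rewrite eq_le word_lim_ge0 andbT.
by apply: le_trans (word_lim_nsq _ _) _; rewrite -rip_nsq rip0l.
Qed.

Lemma vanishingDZ (a : R[i]) (x y : H) :
  vanishing_set x -> vanishing_set y -> vanishing_set (a *: x + y).
Proof.
move=> x0 y0; apply/eqP; rewrite eq_le word_lim_ge0 andbT.
by apply: le_trans (word_lim_lin Tb _ _ _) _; rewrite x0 y0 !mule0 adde0.
Qed.

Lemma vanishing_closed : closed vanishing_set.
Proof.
apply: closed_nsq => h hV; apply/eqP; rewrite eq_le word_lim_ge0 andbT.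
apply/lee_addgt0Pr => e e0; rewrite add0e.
have [g g0 ge] := hV _ (divr_gt0 e0 (ltr0Sn _ 1)).
rewrite -(subrK g h); apply: le_trans (word_limD Tb _ _) _.
rewrite g0 mule0 adde0.
apply: (@le_trans _ _ (2%:E * (nsq (h - g))%:E)%E).
  by rewrite lee_wpmul2l// word_lim_nsq.
by rewrite -EFinM lee_fin; lra.
Qed.

Definition vanishing : closed_subspace H :=
  ClosedSubspace vanishing0 vanishingDZ vanishing_closed.

(** The words starting with [i] are part of all words, so the word sum of
[T_i^* h] at length [k] is at most that of [h] at length [k.+1]. *)
Lemma vanishing_adjoint i h :
  vanishing_set h -> vanishing_set (adjoint (T i) h).
Proof.
move=> h0; apply/eqP; rewrite eq_le word_lim_ge0 andbT -[leRHS]h0.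
apply: le_ereal_inf_tmp => _ [k _ <-].
apply: le_trans (word_sum_decr Tb h (leqnSn k)).
apply: (le_trans (word_lim_le T (adjoint (T i) h) k)).
rewrite word_sumS; apply: esum_ge; exists [set i]; first by split.
by rewrite fsbig_set1.
Qed.

(** The entry in the upper right corner vanishes because [T_i^*] preserves
[vanishing].  If the word sums of the block [B] at [h] tended to 0, then
[block_word_lim] would put [h] in [vanishing], to which it is orthogonal. *)
Lemma vanishing_triangulation : triangulation_C0_C1 T vanishing (orthoc vanishing).
Proof.
have dec := orthoc_decomposition vanishing.
pose A i := compress vanishing vanishing (T i).
pose X i := compress vanishing (orthoc vanishing) (T i).
pose B i := compress (orthoc vanishing) (orthoc vanishing) (T i).
have TAB i : has_lower_block_form (T i) (A i) (X i) (B i).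
  move=> x0 x1; rewrite linearD/= [in LHS](decompE dec (T i (csub_val x0))).
  rewrite -addrA; congr (_ + _).
  suff -> : T i (csub_val x1) = csub_val (B i x1) by [].
  rewrite [LHS](decompE dec) oproj_eq0 ?add0r// => m.
  rewrite inner_conj adjointP.
  have mV := vanishing_adjoint i (csub_val_in m).
  by rewrite inner_conj (csub_val_in x1 _ mV) !conjC0.
split=> //; exists A, X, B; split=> //.
- exact: vanishing_adjoint.
- split; first exact/row_bound_contraction/(block_row_bound0 dec TAB vanishing_adjoint Tb).
  move=> h; rewrite (_ : word_sum A h = word_sum T (csub_val h)).
    by rewrite -[X in _ --> X](csub_val_in h : word_lim T _ = _); exact: word_sum_cvg.
  by apply/funext => k; exact: (block_word_sum0 dec TAB vanishing_adjoint).
- have Bb := block_row_bound1 dec TAB vanishing_adjoint Tb.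
  split; first exact: row_bound_contraction.
  move=> h h0; exists (word_lim B h); first exact: word_sum_cvg.
  apply: contra_neq h0 => lim0; apply: val_inj => /=.
  suff hV : vanishing_set (csub_val h).
    by apply: nsq_eq0; rewrite -rip_nsq /rip (csub_val_in h).
  apply/eqP; rewrite eq_le word_lim_ge0 andbT.
  have cvg2 : (fun k => 2%:E * word_sum B h k)%E @ \oo --> (2%:E * 0)%E.
    by apply: cvgeZl => //; rewrite -lim0; exact: word_sum_cvg.
  rewrite -(mule0 2%:E); apply: (cvge_ge _ cvg2); apply: nearW => k.
  rewrite -[h in leRHS]oproj_val.
  exact: (block_word_lim dec TAB vanishing_adjoint Tb).
Qed.

(** The C.0 condition gives one inclusion.  For the other, the component in [K1] of
a vector of [vanishing] has word sums for [B] tending to 0, so it is 0 by the C.1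
condition. *)
Lemma triangulation_vanishing (K0 K1 : closed_subspace H) :
  triangulation_C0_C1 T K0 K1 -> csub_set K0 = vanishing_set.
Proof.
move=> [dec [A [X [B [TAB Tinv [_ AC0] [_ BC1]]]]]].
have K0V h : csub_set K0 h -> vanishing_set h.
  move=> hK; apply: (cvg_unique (@ereal_hausdorff R) (@word_sum_cvg _ _ _ _ Tb h)).
  have := AC0 (CSub (mem_set hK)).
  rewrite (_ : word_sum A _ = word_sum T h)//.
  by apply/funext => k; rewrite (block_word_sum0 dec TAB Tinv).
apply/seteqP; split=> // h hV.
have hE := decompE dec h.
suff h10 : oproj K1 h = 0 by rewrite hE h10 addr0; exact: csub_val_in.
apply/eqP; apply: contrapT => /negP /BC1[l Bl /eqP]; apply.
apply: (cvg_unique (@ereal_hausdorff R) Bl).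
apply: (squeeze_cvge _ (cvg_cst 0%E) (_ : word_sum T h @ \oo --> 0%E)).
  apply: nearW => k; rewrite word_sum_ge0/=.
  exact: (block_word_sum1 dec TAB Tinv).
by rewrite -[X in _ --> X](hV : word_lim T h = _); exact: word_sum_cvg.
Qed.

End vanishing_subspace.

Theorem theorem4p1 (R : realType) (H : hilbertType R) (n : option nat)
    (n_neq0 : n <> Some 0%N) (T : letters n -> bounded_op H H)
    (T_row_contraction : row_contraction T) :
  exists H0 H1 : closed_subspace H,
    triangulation_C0_C1 T H0 H1 /\
    forall K0 K1 : closed_subspace H, triangulation_C0_C1 T K0 K1 ->
      csub_set K0 = csub_set H0 /\ csub_set K1 = csub_set H1.
Proof.
have Tb := row_contraction_bound T_row_contraction.
exists (vanishing Tb), (orthoc (vanishing Tb)).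
split; first exact: vanishing_triangulation.
move=> K0 K1 K01; have K0E := triangulation_vanishing Tb K01; split=> //.
by case: K01 => /decomp_set1 -> _; rewrite /= /orthoc_set K0E.
Qed.
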